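(* Let $\mathbb{F}$ be a finite field with $|\mathbb{F}|=Q$, $d\ge 1$, $n\ge 0$, let $a_1,\dots,a_n\in\mathbb{F}^d$, $b_1,\dots,b_n\in\mathbb{F}$, let $A_n\in\mathbb{F}^{n\times d}$ have rows $a_1^\top,\dots,a_n^\top$, let $b^{(n)}=(b_1,\dots,b_n)^\top$, and let $W_n=\{w\in\mathbb{F}^d:A_nw=b^{(n)}\}$. Assume $W_n\ne\varnothing$ and let $r=\operatorname{rank}(A_n)$. Then: (i) the number of latent parameters consistent with the context is $|W_n|=Q^{d-r}$; (ii) the set of queries $q\in\mathbb{F}^d$ whose answers are determined is exactly $\operatorname{Row}(A_n)$ and has size $Q^r$; (iii) the number of query vectors $q\in\mathbb{F}^d$ whose answers are underdetermined (not determined) is $Q^d-Q^r$.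
   Context: A query $q\in\mathbb{F}^d$ is determined if $w^\top q$ takes the same value for all $w\in W_n$. $\operatorname{Row}(A_n)\subseteq\mathbb{F}^d$ is the span of the rows of $A_n$ (identified with column vectors). *)

(* Defs.v *)
From HB Require Import structures.
From mathcomp Require Import all_boot all_order all_algebra.

Set Implicit Arguments.
Unset Strict Implicit.
Unset Printing Implicit Defensive.

Import GRing.Theory.
Local Open Scope ring_scope.

Definition context_mx (F : finFieldType) (d n : nat) (a : 'I_n -> 'cV[F]_d) :
  'M[F]_(n, d) := \matrix_(i < n) (a i)^T.

Definition context_col (F : finFieldType) (n : nat) (b : 'I_n -> F) :
  'cV[F]_n := \col_(i < n) b i.

Definition consistent (F : finFieldType) (d n : nat) (A : 'M[F]_(n, d))
  (b : 'cV[F]_n) : {set 'cV[F]_d} := [set w | A *m w == b].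

(* [w^T *m q] is a 1 x 1 matrix; its unique entry is the scalar product. *)
Definition answer (F : finFieldType) (d : nat) (w q : 'cV[F]_d) : F :=
  (w^T *m q) ord0 ord0.

Definition determined (F : finFieldType) (d : nat) (W : {set 'cV[F]_d})
  (q : 'cV[F]_d) : bool :=
  [forall w in W, forall w' in W, answer w q == answer w' q].

(* MathComp row spaces consist of row vectors, queries are column vectors,
   hence the transpose. *)
Definition Row (F : finFieldType) (d n : nat) (A : 'M[F]_(n, d)) :
  {set 'cV[F]_d} := [set q | (q^T <= A)%MS].

(* Main.v *)
(* A nonempty solution set [W] is a translate [w0 + ker A].  A query is thus
   determined iff it is orthogonal to [ker A], i.e. iff it lies in the row
   space of [A]; both counts follow from rank-nullity. *)
Require Import Defs.
From HB Require Import structures.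
From mathcomp Require Import all_boot all_order all_algebra.
From mathcomp Require Import mxabelem.

Set Implicit Arguments.
Unset Strict Implicit.
Unset Printing Implicit Defensive.

Import GRing.Theory.
Local Open Scope ring_scope.

Lemma card_consistent (F : finFieldType) (d n : nat) (A : 'M[F]_(n, d))
    (b : 'cV[F]_n) :
  consistent A b != set0 -> #|consistent A b| = (#|F| ^ (d - \rank A))%N.
Proof.
case/set0Pn=> w0; rewrite inE => /eqP Aw0.
have inj_f : injective (fun u : 'rV[F]_d => w0 + u^T).
  by move=> u v /addrI/trmx_inj.
(* [kermx] is a left kernel of row vectors, so the null space of [A] enters as the transposes of the
   rows in [kermx A^T]. *)
rewrite -(mxrank_tr A) -mxrank_ker -card_rowg -(card_imset (rowg _) inj_f).
apply: eq_card => w; rewrite [w \in _]inE.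
apply/eqP/imsetP => [Aw | [u + ->]].
  exists (w - w0)^T; last by rewrite trmxK addrC subrK.
  by rewrite inE sub_kermx -trmx_mul mulmxBr Aw Aw0 subrr trmx0.
rewrite inE => /sub_kermxP uA0.
by rewrite mulmxDr Aw0 -[A]trmxK -trmx_mul uA0 trmx0 addr0.
Qed.

Lemma determined_Row (F : finFieldType) (d n : nat) (A : 'M[F]_(n, d))
    (b : 'cV[F]_n) (q : 'cV[F]_d) :
  consistent A b != set0 -> determined (consistent A b) q = (q \in Row A).
Proof.
case/set0Pn=> w0 Ww0; have Aw0 : A *m w0 = b by move: Ww0; rewrite inE => /eqP.
rewrite inE; apply/forall_inP/idP => [det_q | /submxP[D qD] w Ww].
  (* The columns of [cokermx A] lie in [ker A] and cut out the row space. *)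
  rewrite submxE -trmx_eq0 trmx_mul trmxK; apply/eqP/row_matrixP=> i.
  rewrite row_mul row0 -tr_col; set v := col i _.
  have Av0 : A *m v = 0 by rewrite /v colE mulmxA mulmx_coker mul0mx.
  have Ww : w0 + v \in consistent A b by rewrite inE mulmxDr Av0 addr0 Aw0.
  (* Equal answers at the solutions [w0] and [w0 + v] force [v^T *m q] to vanish. *)
  have /forall_inP/(_ _ Ww)/eqP := det_q _ Ww0.
  rewrite /answer linearD /= mulmxDl [RHS]mxE -[LHS]addr0 => /addrI vq0.
  by apply/matrixP=> j k; rewrite !ord1 -vq0 mxE.
(* With [q^T = D *m A], the product [w^T *m q] equals [(A *m w)^T *m D^T = b^T *m D^T], which is the
   same for every solution [w]. *)
apply/forall_inP=> w' Ww'; rewrite /answer -(trmxK q) qD trmx_mul !mulmxA.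
by move: Ww Ww'; rewrite !inE -!trmx_mul => /eqP-> /eqP->.
Qed.

(** Transposition is a bijection from [rowg A], an [F]-space of dimension [\rank A], onto
    [Row A]. *)
Lemma card_Row (F : finFieldType) (d n : nat) (A : 'M[F]_(n, d)) :
  #|Row A| = (#|F| ^ \rank A)%N.
Proof.
rewrite -card_rowg -(card_imset (rowg A) (@trmx_inj F 1 d)).
apply: eq_card => q; rewrite inE; apply/idP/imsetP => [qA | [u + ->]].
  by exists q^T; rewrite ?inE ?trmxK.
by rewrite inE trmxK.
Qed.

Theorem theorem5p3 (F : finFieldType) (Q : nat) (hQ : #|F| = Q)
  (d n : nat) (hd : (1 <= d)%N)
  (a : 'I_n -> 'cV[F]_d) (b : 'I_n -> F) :
  let A := context_mx a in
  let W := consistent A (context_col b) in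
  let r := \rank A in
  W != set0 ->
  [/\ #|W| = (Q ^ (d - r))%N,
      [set q : 'cV[F]_d | determined W q] = Row A
        /\ #|[set q : 'cV[F]_d | determined W q]| = (Q ^ r)%N
    & #|[set q : 'cV[F]_d | ~~ determined W q]| = (Q ^ d - Q ^ r)%N].
Proof.
move=> A W r W0.
have detE : [set q | determined W q] = Row A.
  by apply/setP=> q; rewrite inE determined_Row.
split; first by rewrite card_consistent // hQ.
  by rewrite detE card_Row hQ.
have -> : [set q | ~~ determined W q] = ~: Row A.
  by apply/setP=> q; rewrite -detE !inE.
(* The ambient space of [d x 1] matrices has [Q ^ (d * 1)] elements. *)
by rewrite cardsCs setCK card_Row card_mx hQ muln1.
Qed.
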